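(* Let $m\ge3$ be odd and $k\ge m-2$. Then $$\Delta_{\mathbb{R}^{m+1}}^{\frac{m-3}2}\mathcal{D}\,x^k=\gamma_m\frac{k!}{(k-m+2)!}\,HGCK[x_0^{k-m+2},0]=\gamma_m\frac{k!}{(k-m+2)!}\,\mathcal{P}_{k-m+2}^m(x),\qquad x\in\mathbb{R}^{m+1},$$ where $\gamma_m=\frac{(-1)^{\frac{m-1}2}2^{m-1}}{(m-1)!}\left[\Gamma\left(\frac{m+1}2\right)\right]^2$ and $\mathcal{P}_n^m(x)=\sum_{s=0}^n\binom ns\frac{\left(\frac{m-1}2\right)_{n-s}\left(\frac{m-1}2\right)_s}{(m-1)_n}x^{n-s}\bar{x}^s$.
   Context: $\mathbb{R}_m$ is the real associative Clifford algebra generated by $e_1,\dots,e_m$ with $e_je_\ell+e_\ell e_j=-2\delta_{j\ell}$; points of $\mathbb{R}^{m+1}$ are paravectors $x=x_0+\underline{x}$, $\underline{x}=\sum_{j=1}^mx_je_j$, $\bar{x}=x_0-\underline{x}$. $\Delta_{\mathbb{R}^{m+1}}=\sum_{j=0}^m\partial_{x_j}^2$, $\mathcal{D}=\partial_{x_0}+\sum_{j=1}^me_j\partial_{x_j}$. $(a)_s=\Gamma(a+s)/\Gamma(a)$. For analytic $A_0,A_1$ of the real variable $x_0$, $$HGCK[A_0,A_1](x_0,\underline{x})=\Gamma\left(\tfrac m2\right)\left[\sum_{j\ge0}\frac{(-1)^j|\underline{x}|^{2j}A_0^{(2j)}(x_0)}{2^{2j}j!\,\Gamma(\frac m2+j)}+\frac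 m2\,\underline{x}\sum_{j\ge0}\frac{(-1)^j|\underline{x}|^{2j}A_1^{(2j)}(x_0)}{2^{2j}j!\,\Gamma(\frac m2+j+1)}\right]$$ is the harmonic generalized CK-extension. *)

(* Defs.v *)
From HB Require Import structures.
From mathcomp Require Import all_boot all_order all_algebra.

Set Implicit Arguments.
Unset Strict Implicit.
Unset Printing Implicit Defensive.

Import Order.TTheory GRing.Theory Num.Theory.

Local Open Scope ring_scope.

(** An element of R_m is given by its coordinates on the basis
    e_A = e_(j_1) ... e_(j_r), A = {j_1 < ... < j_r}, with A ranging over the
    subsets of 'I_m; the paper's e_1, ..., e_m are indexed here from 0. *)
Definition clifford (R : comNzRingType) (m : nat) : Type :=
  {ffun {set 'I_m} -> R^o}.

HB.instance Definition _ (R : comNzRingType) (m : nat) :=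
  GRing.Lmodule.copy (clifford R m) {ffun {set 'I_m} -> R^o}.

Section CliffordRing.
Context {R : comNzRingType} {m : nat}.
Implicit Types (A B C : {set 'I_m}) (a b c : clifford R m).

Definition ccoord a A : R := (a : {ffun {set 'I_m} -> R^o}) A.

Definition symdiff A B : {set 'I_m} := (A :\: B) :|: (B :\: A).

(** e_A e_B = (-1)^(inversions A B) e_(symdiff A B): moving the e_j, j in B, to
    their places costs one sign for each pair i > j with i in A, and each
    common index contributes e_j ^ 2 = -1. *)
Definition inversions A B : nat :=
  (\sum_(i in A) \sum_(j in B) ((j <= i)%N : nat))%N.

Definition blade A : clifford R m := [ffun C => (C == A)%:R].

(** As symdiff A B = C iff B = symdiff A C, the e_C coordinate of a product is
    a sum over A alone. *)
Definition cmul a b : clifford R m :=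
  [ffun C => \sum_A (-1) ^+ inversions A (symdiff A C)
                      * ccoord a A * ccoord b (symdiff A C)].

Definition cone : clifford R m := blade set0.

Lemma in_symdiff A B i : (i \in symdiff A B) = (i \in A) (+) (i \in B).
Proof. by rewrite !inE; case: (i \in A); case: (i \in B). Qed.

Lemma symdiffA A B C : symdiff A (symdiff B C) = symdiff (symdiff A B) C.
Proof. by apply/setP => i; rewrite !in_symdiff addbA. Qed.

Lemma symdiffC A B : symdiff A B = symdiff B A.
Proof. by apply/setP => i; rewrite !in_symdiff addbC. Qed.

Lemma symdiffK A : involutive (symdiff A).
Proof. by move=> B; apply/setP => i; rewrite !in_symdiff addbA addbb. Qed.

Lemma symdiff0s A : symdiff set0 A = A.
Proof. by apply/setP => i; rewrite !in_symdiff !inE. Qed.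

Lemma symdiffs0 A : symdiff A set0 = A.
Proof. by rewrite symdiffC symdiff0s. Qed.

Lemma symdiffss A : symdiff A A = set0.
Proof. by apply/setP => i; rewrite !in_symdiff addbb inE. Qed.

Lemma odd_sum (I : finType) (P : pred I) (F : I -> nat) :
  odd (\sum_(i | P i) F i) = \big[addb/false]_(i | P i) odd (F i).
Proof. by apply: (big_morph odd oddD). Qed.

Lemma odd_inversions A B : odd (inversions A B) =
  \big[addb/false]_i \big[addb/false]_j
     [&& i \in A, j \in B & (j <= i)%N].
Proof.
rewrite /inversions odd_sum big_mkcond; apply: eq_bigr => i _.
case: ifP => iA; last by rewrite big1.
rewrite odd_sum big_mkcond; apply: eq_bigr => j _.
by case: ifP => //= _; case: leqP.
Qed.

Lemma odd_inversionsDl A B C :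
  odd (inversions (symdiff A B) C)
  = odd (inversions A C) (+) odd (inversions B C).
Proof.
rewrite !odd_inversions -big_split; apply: eq_bigr => i _ /=.
rewrite -big_split; apply: eq_bigr => j _ /=; rewrite in_symdiff.
by case: (i \in A); case: (i \in B); case: (j \in C); case: leqP.
Qed.

Lemma odd_inversionsDr A B C :
  odd (inversions A (symdiff B C))
  = odd (inversions A B) (+) odd (inversions A C).
Proof.
rewrite !odd_inversions -big_split; apply: eq_bigr => i _ /=.
rewrite -big_split; apply: eq_bigr => j _ /=; rewrite in_symdiff.
by case: (i \in A); case: (j \in B); case: (j \in C); case: leqP.
Qed.

Lemma inversions0s A : inversions set0 A = 0%N.
Proof. by rewrite /inversions big_set0. Qed.

Lemma inversionss0 A : inversions A set0 = 0%N.
Proof. by rewrite /inversions big1 // => i _; rewrite big_set0. Qed.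

Lemma ccoordE a : a = [ffun A => ccoord a A].
Proof. by apply/ffunP => A; rewrite ffunE. Qed.

Lemma cliffordP a b : (forall A, ccoord a A = ccoord b A) -> a = b.
Proof. by move=> ab; apply/ffunP => A; apply: ab. Qed.

Lemma ccoordD a b A : ccoord (a + b) A = ccoord a A + ccoord b A.
Proof. by rewrite /ccoord ffunE. Qed.

Lemma ccoordZ (r : R) a A : ccoord (r *: a) A = r * ccoord a A.
Proof. by rewrite /ccoord ffunE. Qed.

Lemma ccoord_blade A B : ccoord (blade A) B = (B == A)%:R.
Proof. by rewrite /ccoord ffunE. Qed.

Lemma ccoordM a b C : ccoord (cmul a b) C =
  \sum_A (-1) ^+ inversions A (symdiff A C)
         * ccoord a A * ccoord b (symdiff A C).
Proof. by rewrite /ccoord ffunE. Qed.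

Lemma cmulA : associative cmul.
Proof.
move=> a b c; apply: cliffordP => D; rewrite !ccoordM.
under eq_bigr => A _.
  rewrite ccoordM mulr_sumr.
  rewrite (reindex_inj (inv_inj (symdiffK A))) /=.
  over.
rewrite exchange_big /=; apply: eq_bigr => B _.
rewrite ccoordM mulr_sumr mulr_suml; apply: eq_bigr => A _.
have -> : symdiff (symdiff A B) (symdiff A D) = symdiff B D.
  by rewrite (symdiffC A B) -symdiffA symdiffK.
set sB := symdiff A B; set sD := symdiff B D.
have sAD : symdiff A D = symdiff sB sD by rewrite /sB /sD -symdiffA symdiffK.
have sign_eq : (-1) ^+ inversions A (symdiff A D) * (-1) ^+ inversions sB sD
               = (-1) ^+ inversions B sD * (-1) ^+ inversions A sB :> R.
  rewrite sAD -!exprD -signr_odd -[in RHS]signr_odd !oddD odd_inversionsDr.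
  have -> : odd (inversions sB sD)
            = odd (inversions A sD) (+) odd (inversions B sD).
    exact: odd_inversionsDl.
  congr (_ ^+ nat_of_bool _).
  by case: odd; case: odd; case: odd.
set x := ccoord a A; set y := ccoord b sB; set z := ccoord c sD.
set p := _ ^+ _ in sign_eq *; set q := _ ^+ _ in sign_eq *.
set r := _ ^+ _ in sign_eq *; set s := _ ^+ _ in sign_eq *.
have -> : p * x * (q * y * z) = p * q * (x * y * z).
  by rewrite -!mulrA (mulrCA x q).
by rewrite sign_eq -!mulrA.
Qed.

Lemma cmul1 : left_id cone cmul.
Proof.
move=> a; apply: cliffordP => C; rewrite ccoordM (bigD1 set0) //= big1.
  by rewrite symdiff0s inversions0s ccoord_blade eqxx !mul1r addr0.
by move=> A nA; rewrite ccoord_blade (negPf nA) mulr0 mul0r.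
Qed.

Lemma cmulr1 : right_id cone cmul.
Proof.
move=> a; apply: cliffordP => C; rewrite ccoordM (bigD1 C) //= big1.
  by rewrite symdiffss inversionss0 ccoord_blade eqxx mul1r mulr1 addr0.
move=> A nA; rewrite ccoord_blade; case: eqP => [AC|]; last by rewrite mulr0.
by case/eqP: nA; rewrite -(symdiffs0 A) -AC symdiffK.
Qed.

Lemma cmulDl : left_distributive cmul +%R.
Proof.
move=> a b c; apply: cliffordP => C; rewrite ccoordD !ccoordM -big_split.
by apply: eq_bigr => A _ /=; rewrite ccoordD mulrDr mulrDl.
Qed.

Lemma cmulDr : right_distributive cmul +%R.
Proof.
move=> a b c; apply: cliffordP => C; rewrite ccoordD !ccoordM -big_split.
by apply: eq_bigr => A _ /=; rewrite ccoordD mulrDr.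
Qed.

Lemma cone_neq0 : cone != 0.
Proof.
apply/eqP => /(congr1 (fun a => ccoord a set0)) /eqP.
by rewrite ccoord_blade eqxx /ccoord ffunE oner_eq0.
Qed.

Lemma cscaleAl (r : R) a b : r *: cmul a b = cmul (r *: a) b.
Proof.
apply: cliffordP => C; rewrite ccoordZ !ccoordM mulr_sumr.
by apply: eq_bigr => A _; rewrite ccoordZ !mulrA [r * _]mulrC.
Qed.

Lemma cscaleAr (r : R) a b : r *: cmul a b = cmul a (r *: b).
Proof.
apply: cliffordP => C; rewrite ccoordZ !ccoordM mulr_sumr.
by apply: eq_bigr => A _; rewrite ccoordZ mulrCA.
Qed.

End CliffordRing.

HB.instance Definition _ (R : comNzRingType) (m : nat) :=
  GRing.Zmodule_isNzRing.Build (clifford R m)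
    cmulA cmul1 cmulr1 cmulDl cmulDr cone_neq0.

HB.instance Definition _ (R : comNzRingType) (m : nat) :=
  GRing.Lmodule_isLalgebra.Build R (clifford R m) cscaleAl.

HB.instance Definition _ (R : comNzRingType) (m : nat) :=
  GRing.Lalgebra_isAlgebra.Build R (clifford R m) cscaleAr.

Definition cgen {R : comNzRingType} {m : nat} (j : 'I_m) : clifford R m :=
  blade [set j].

Section CliffordFacts.
Context {R : comNzRingType} {m : nat}.

Lemma bladeM (A B : {set 'I_m}) :
  blade A * blade B
  = (-1) ^+ inversions A B *: blade (symdiff A B) :> clifford R m.
Proof.
apply: cliffordP => C; rewrite ccoordZ ccoord_blade ccoordM (bigD1 A) //= big1.
  rewrite !ccoord_blade eqxx mulr1 addr0.
  have -> : (symdiff A C == B) = (C == symdiff A B).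
    by rewrite -(inj_eq (inv_inj (symdiffK A))) symdiffK.
  by case: eqP => [->|]; rewrite ?mulr0 // symdiffK.
by move=> D nD; rewrite ccoord_blade (negPf nD) mulr0 mul0r.
Qed.

Lemma cgen_anticomm (j l : 'I_m) :
  cgen j * cgen l + cgen l * cgen j = (- 2 * (j == l)%:R)%:A :> clifford R m.
Proof.
rewrite /cgen !bladeM (symdiffC [set l]) -scalerDl /inversions !big_set1.
have [->|njl] := eqVneq j l.
  by rewrite symdiffss leqnn mulr1 expr1 -opprD.
rewrite mulr0 scale0r.
have [jl|lj|/val_inj jl] := ltngtP j l; last by rewrite jl eqxx in njl.
  by rewrite expr0 expr1 subrr scale0r.
by rewrite expr0 expr1 addNr scale0r.
Qed.

Lemma bladeE (A : {set 'I_m}) :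
  blade A = \prod_(j <- enum A) cgen j :> clifford R m.
Proof.
have : sorted ltn [seq val j | j <- enum A].
  rewrite (subseq_sorted ltn_trans _ (iota_ltn_sorted 0 m)) //.
  rewrite -val_enum_ord; apply: map_subseq.
  by rewrite enumT [enum A]/enum_mem filter_subseq.
rewrite -[in blade A](set_enum A); elim: (enum A) => [_|j s IHs] /=.
  by rewrite big_nil set_nil.
rewrite (path_sortedE ltn_trans) => /andP[/allP js /IHs].
rewrite big_cons => <-; rewrite bladeM.
have sj i : i \in s -> (j < i)%N by move=> si; apply: js; apply: map_f.
rewrite /inversions big_set1 big1 => [|i]; last first.
  by rewrite inE => /sj; rewrite ltnNge => /negPf ->.
rewrite expr0 scale1r; congr blade; apply/setP => i; rewrite in_symdiff !inE.
case: eqP => [->|//]; case sjj: (j \in s) => //.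
by have := sj j sjj; rewrite ltnn.
Qed.

End CliffordFacts.

(** Not loaded earlier: classical_sets shadows finset notations used above. *)
From mathcomp Require Import all_classical all_reals all_analysis.
Import numFieldNormedType.Exports.

Local Open Scope classical_set_scope.
Local Open Scope ring_scope.

Section CliffordAnalysis.
Context {R : realType} {m : nat}.

(** A point of R^(m+1) is a row vector whose entry 0 is x_0. *)
Definition xvec (x : 'rV[R]_m.+1) : 'rV[R]_m := \row_j x 0 (lift ord0 j).

Definition vec (v : 'rV[R]_m) : clifford R m := \sum_(j < m) v 0 j *: cgen j.

Definition paravector (x : 'rV[R]_m.+1) : clifford R m :=
  (x 0 0)%:A + vec (xvec x).

Definition paraconj (x : 'rV[R]_m.+1) : clifford R m :=
  (x 0 0)%:A - vec (xvec x).

Definition enorm (v : 'rV[R]_m) : R := Num.sqrt (\sum_(j < m) v 0 j ^+ 2).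

(** Derivatives and infinite sums of R_m-valued functions and sequences are
    taken coordinatewise. *)
Definition partial (j : 'I_m.+1) (f : 'rV[R]_m.+1 -> clifford R m)
    (x : 'rV[R]_m.+1) : clifford R m :=
  [ffun A => 'D_(delta_mx 0 j) (fun y => ccoord (f y) A) x].

Definition cderiv (n : nat) (f : R -> clifford R m) (t : R) : clifford R m :=
  [ffun A => derive1n n (fun s => ccoord (f s) A) t].

Definition cseries (u : nat -> clifford R m) : clifford R m :=
  [ffun A => limn (series (fun j => ccoord (u j) A))].

Definition laplacian (f : 'rV[R]_m.+1 -> clifford R m) (x : 'rV[R]_m.+1) :
    clifford R m :=
  \sum_(j < m.+1) partial j (partial j f) x.

Definition dirac_op (f : 'rV[R]_m.+1 -> clifford R m) (x : 'rV[R]_m.+1) :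
    clifford R m :=
  partial ord0 f x + \sum_(j < m) cgen j * partial (lift ord0 j) f x.

End CliffordAnalysis.

(** Euler's integral; it is only used at positive arguments. *)
Definition Gamma {R : realType} (s : R) : R :=
  Rintegral lebesgue_measure `]0, +oo[ (fun t => t `^ (s - 1) * expR (- t)).

Definition pochhammer {R : realType} (a : R) (s : nat) : R :=
  Gamma (a + s%:R) / Gamma a.

(** The initial data are allowed to be R_m-valued. *)
Definition HGCK {R : realType} {m : nat} (A0 A1 : R -> clifford R m)
    (x0 : R) (v : 'rV[R]_m) : clifford R m :=
  Gamma (m%:R / 2) *:
    (cseries (fun j =>
       ((-1) ^+ j * enorm v ^+ (2 * j)
         / (2 ^+ (2 * j) * j`!%:R * Gamma (m%:R / 2 + j%:R)))
       *: cderiv (2 * j) A0 x0)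
     + (m%:R / 2) *: (vec v *
         cseries (fun j =>
           ((-1) ^+ j * enorm v ^+ (2 * j)
             / (2 ^+ (2 * j) * j`!%:R * Gamma (m%:R / 2 + j%:R + 1)))
           *: cderiv (2 * j) A1 x0))).

Definition gamma_const (R : realType) (m : nat) : R :=
  (-1) ^+ (m.-1)./2 * 2 ^+ m.-1 / (m.-1)`!%:R * Gamma (m.+1%:R / 2) ^+ 2.

Definition Ppoly {R : realType} (m n : nat) (x : 'rV[R]_m.+1) : clifford R m :=
  \sum_(0 <= s < n.+1)
    ('C(n, s)%:R * (pochhammer (m.-1%:R / 2) (n - s) * pochhammer (m.-1%:R / 2) s
                     / pochhammer m.-1%:R n))
    *: (paravector x ^+ (n - s) * paraconj x ^+ s).

(* Main.v *)
Require Import Defs.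
From mathcomp Require Import all_boot all_order all_algebra.
From mathcomp Require Import ring lra zify.
From mathcomp Require Import all_classical all_reals all_analysis.
From mathcomp Require Import measurable_realfun.
Import Order.TTheory GRing.Theory Num.Theory.
Import numFieldNormedType.Exports.
Local Open Scope ring_scope.

(** Write [v] for the vector part of [x], [w = v^2 = -|v|^2], and
    [H_b,n = \sum_j n^_(2j) / (4^j j! (b)_j) x_0^(n-2j) w^j]. As [x^k] lies in the
    span of [1] and [v], [\sum_j e_j x^k e_j = (1 - m) xbar^k] (over
    [e_0 = 1, e_1, ..., e_m]), so the Leibniz rule
    [D x^(k+1) = (D x^k) x + \sum_j e_j x^k e_j] gives
    [D x^k = (1 - m) \sum_s x^(k-1-s) xbar^s]. Both this sum and [P_n^m] are
    Gegenbauer sums, of index 1 and (m - 1)/2: they satisfy the same three-term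
    recurrence as [H_b,n] with [b] the index plus 1/2, whence
    [D x^k = (1 - m) k H_(3/2,k-1)] and [P_n^m = H_(m/2,n)]; and the latter is also
    the (finite) series defining [HGCK]. Finally the Laplacian sends [H_b,n] to
    [n (n-1) (2b - m)/(2b) H_(b+1,n-2)], so that [(m - 3)/2] steps lead from
    [b = 3/2] to [b = m/2]. *)

(** * Rising and falling factorials *)

(** The Pochhammer symbol as a finite product, for purely algebraic use; for [1 <= a] it agrees with
    the quotient of Gamma values ([pochhammerE]). *)
Definition rising {R : pzSemiRingType} (a : R) (n : nat) : R :=
  \prod_(i < n) (a + i%:R).

Lemma risingS {R : pzSemiRingType} (a : R) n :
  rising a n.+1 = rising a n * (a + n%:R).
Proof. by rewrite /rising big_ord_recr. Qed.

Lemma rising_gt0 {R : numDomainType} (a : R) n : 0 < a -> 0 < rising a n.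
Proof. by move=> a0; apply: prodr_gt0 => i _; rewrite ltr_wpDr. Qed.

Lemma rising_shift {R : pzSemiRingType} (a : R) n :
  rising a n.+1 = a * rising (a + 1) n.
Proof.
rewrite /rising big_ord_recl addr0; congr (_ * _); apply: eq_bigr => i _.
by rewrite lift0 -addrA -natr1 (addrC 1).
Qed.

(** The difference is taken in the ring and may be negative; where it is, [j] exceeds [n] and both
    falling factorials vanish. *)
Lemma natr_ffactSr {R : pzRingType} (n j : nat) :
  (n ^_ j.+1)%:R = (n ^_ j)%:R * (n%:R - j%:R) :> R.
Proof.
rewrite ffactnSr natrM; have [jn|nj] := leqP j n; first by rewrite natrB.
by rewrite ffact_small // !mul0r.
Qed.

Lemma natr_ffactSS {R : pzSemiRingType} (n j : nat) :
  (n.+1 ^_ j.+1)%:R = n.+1%:R * (n ^_ j)%:R :> R.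
Proof. by rewrite ffactSS natrM. Qed.

(** * Gegenbauer sums and their three-term recurrence *)

Section Gegenbauer.

(** If [sum T_i t^i] and [sum U_i t^i] solve [(1 - x t) f' = L x f] and
    [(1 - y t) f' = L y f], this is the recurrence for the coefficients of
    their product. *)
Lemma cauchy_product_rec {A : comPzRingType} (L x y : A) (T U : nat -> A)
    (G := fun n => \sum_(s < n.+1) T (n - s)%N * U s) (n : nat) :
  (forall s, s.+1%:R * T s.+1 = (L + s%:R) * x * T s) ->
  (forall s, s.+1%:R * U s.+1 = (L + s%:R) * y * U s) ->
  n.+2%:R * G n.+2
  = (L + n.+1%:R) * (x + y) * G n.+1 - (2 * L + n%:R) * (x * y) * G n.
Proof.
move=> recT recU.
(* [GU] and [GT] are the coefficients obtained by applying [t d/dt] to one factor of the product;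
   their sum is [t d/dt] of the whole product. *)
pose GU n := \sum_(s < n.+1) s%:R * (T (n - s)%N * U s).
pose GT n := \sum_(s < n.+1) (n - s)%:R * (T (n - s)%N * U s).
have GTU p : GT p + GU p = p%:R * G p.
  rewrite mulr_sumr -big_split; apply: eq_bigr => s _ /=.
  by rewrite -mulrDl -natrD subnK // -ltnS.
have GUS p : GU p.+1 = y * (L * G p + GU p).
  rewrite /GU big_ord_recl mul0r add0r mulr_sumr -big_split mulr_sumr.
  apply: eq_bigr => s _; rewrite lift0 subSS mulrCA recU /=; ring.
have GTS p : GT p.+1 = x * (L * G p + GT p).
  rewrite /GT big_ord_recr /= subnn mul0r addr0 mulr_sumr -big_split mulr_sumr.
  apply: eq_bigr => s _; rewrite subSn -1?ltnS // mulrA recT /=; ring.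
have GTE : n.+1%:R * G n.+1 - GU n.+1 = x * (L * G n + GT n).
  by rewrite -GTU addrK GTS.
rewrite -GTU GTS.
(* Completing [GT] and [GU] to [n.+1%:R * G n.+1] leaves the cross terms [x * GU] and [y * GT]; a
   second use of the first-order recurrences makes [x * y] appear. *)
transitivity ((L + n.+1%:R) * (x + y) * G n.+1 - x * GU n.+1
              - y * (n.+1%:R * G n.+1 - GU n.+1)).
  have -> : GT n.+1 = n.+1%:R * G n.+1 - GU n.+1 by rewrite -GTU addrK.
  by rewrite (GUS n.+1); ring.
have -> : (2 * L + n%:R) * (x * y) * G n
          = 2 * L * (x * y) * G n + x * y * (n%:R * G n) by ring.
by rewrite GTE GUS -GTU; ring.
Qed.

Context {R : realFieldType}.
Implicit Types (b l : R).

(** The coefficient of [x0^(n-2j) w^j] in [H_b,n]. The falling factorial kills it for [n < 2j], so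
    truncated exponents [n - 2 * j] do no harm. *)
Definition hcoef b (n j : nat) : R :=
  (n ^_ (2 * j))%:R / (4 ^+ j * j`!%:R * rising b j).

Lemma hcoef_small b n j : (n < 2 * j)%N -> hcoef b n j = 0.
Proof. by move=> nj; rewrite /hcoef ffact_small // mul0r. Qed.

Lemma hcoef0 b n : hcoef b n 0 = 1.
Proof. by rewrite /hcoef fact0 /rising big_ord0 expr0 !mulr1 divr1. Qed.

Lemma hcoef_den b j : 0 < b -> 4 ^+ j * j`!%:R * rising b j != 0.
Proof.
by move=> b0; rewrite !mulf_neq0 ?expf_neq0 ?pnatr_eq0 ?lt0r_neq0 ?fact_gt0
  ?rising_gt0 -?lt0n ?fact_gt0.
Qed.

(** Coefficient form of [hpoly_rec]. Every falling factorial involved is a multiple of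
    [n ^_ (2 * j)], which reduces the claim to a rational identity. *)
Lemma hcoef_rec l n j : 0 < l ->
  (2 * l + n.+1%:R) * hcoef (l + 2^-1) n.+2 j.+1
  = 2 * (l + n.+1%:R) * hcoef (l + 2^-1) n.+1 j.+1
    - n.+1%:R * (hcoef (l + 2^-1) n j.+1 - hcoef (l + 2^-1) n j).
Proof.
move=> l0; have b0 : 0 < l + 2^-1 by rewrite addr_gt0 // invr_gt0.
rewrite /hcoef (_ : 2 * j.+1 = (2 * j).+2)%N; last by lia.
rewrite !natr_ffactSS !natr_ffactSr factS exprS risingS natrM.
have d0 := hcoef_den _ j b0.
have bj0 : l + 2^-1 + j%:R != 0 by rewrite lt0r_neq0 // ltr_wpDr.
move: d0; rewrite !mulf_eq0 !negb_or => /andP[/andP[p0 f0] r0].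
have j0 : j.+1%:R != 0 :> R by rewrite pnatr_eq0.
move: (4 ^+ j) (j`!%:R) (rising _ j) p0 f0 r0 => P f r p0 f0 r0.
field; rewrite r0 f0 p0 nat1r j0 andbT /=.
by move: bj0; apply: contra_neq => e; lra.
Qed.

(** The coefficient of [x0^(n-2j) w^j] in the Laplacian, [w = -|v|^2], of
    [\sum_j hcoef b n.+2 j x0^(n.+2-2j) w^j]. *)
Lemma hcoef_laplacian b mu n j : 0 < b ->
  (n.+2 ^_ (2 * j.+1))%:R / (4 ^+ j * j`!%:R * rising b j)
    - hcoef b n.+2 j.+1 * (2 * j.+1%:R * (2 * j%:R + mu))
  = n.+2%:R * n.+1%:R * ((2 * b - mu) / (2 * b)) * hcoef (b + 1) n j.
Proof.
move=> b0; rewrite /hcoef (_ : 2 * j.+1 = (2 * j).+2)%N; last by lia.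
rewrite !natr_ffactSS factS exprS natrM.
have bE : b * rising (b + 1) j = rising b j * (b + j%:R).
  by rewrite -rising_shift risingS.
have bj0 : b + j%:R != 0 by rewrite lt0r_neq0 // ltr_wpDr.
have b1 : b != 0 by rewrite lt0r_neq0.
have rE : rising b j = b * rising (b + 1) j / (b + j%:R).
  by rewrite bE mulfK.
rewrite risingS rE.
have b10 : 0 < b + 1 by rewrite addr_gt0.
have := hcoef_den _ j b10.
rewrite !mulf_eq0 !negb_or => /andP[/andP[p0 f0] r0].
have j0 : j.+1%:R != 0 :> R by rewrite pnatr_eq0.
move: (4 ^+ j) (j`!%:R) (rising _ j) p0 f0 r0 => P f r p0 f0 r0.
by field; rewrite r0 f0 p0 nat1r j0 b1 bj0.
Qed.

Section Algebra.
Context {A : comAlgType R}.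
Implicit Types (a w x y : A).

(** [H_b,n] at [x0 = a]. The bound [J] is any truncation with [n < 2 * J]; sharing it lets
    consecutive degrees be sums over one index set. *)
Definition hpoly (J : nat) b n a w : A :=
  \sum_(j < J) hcoef b n j *: (a ^+ (n - 2 * j) * w ^+ j).

Lemma hcoef_exprS b n j a (z : A) :
  hcoef b n j *: (a * (a ^+ (n - 2 * j) * z))
  = hcoef b n j *: (a ^+ (n.+1 - 2 * j) * z).
Proof.
have [jn|nj] := leqP (2 * j) n; first by rewrite subSn // exprS mulrA.
by rewrite hcoef_small // !scale0r.
Qed.

Lemma hpoly_rec J l n a w : 0 < l -> (n.+2 < 2 * J)%N ->
  (2 * l + n.+1%:R) *: hpoly J (l + 2^-1) n.+2 a w
  = (2 * (l + n.+1%:R)) *: (a * hpoly J (l + 2^-1) n.+1 a w)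
    - n.+1%:R *: ((a ^+ 2 - w) * hpoly J (l + 2^-1) n a w).
Proof.
move=> l0; case: J => [//|J] nJ; set b := l + _.
(* Multiplication by [w] shifts the index; the top term drops out because [n < 2 * J] for the
   decremented [J]. *)
have mulwE : w * hpoly J.+1 b n a w
    = \sum_(j < J) hcoef b n j *: (a ^+ (n - 2 * j) * w ^+ j.+1).
  rewrite /hpoly big_ord_recr /= (hcoef_small _ n J) ?scale0r ?addr0;
    last by lia.
  rewrite mulr_sumr; apply: eq_bigr => j _.
  by rewrite -scalerAr mulrCA -exprS.
have mulaE p : a * hpoly J.+1 b p a w
    = \sum_(j < J.+1) hcoef b p j *: (a ^+ (p.+1 - 2 * j) * w ^+ j).
  rewrite mulr_sumr; apply: eq_bigr => j _.
  by rewrite -scalerAr hcoef_exprS.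
have mulaaE p : a ^+ 2 * hpoly J.+1 b p a w
    = \sum_(j < J.+1) hcoef b p j *: (a ^+ (p.+2 - 2 * j) * w ^+ j).
  rewrite expr2 -mulrA mulaE mulr_sumr; apply: eq_bigr => j _.
  rewrite -scalerAr; have [jn|nj] := leqP (2 * j) p.
    by rewrite !subSn ?(leqW jn) // (exprS a (p - _).+1) mulrA.
  by rewrite hcoef_small // !scale0r.
rewrite mulrBl mulwE mulaE mulaaE /hpoly !big_ord_recl !hcoef0 !expr0 !subn0.
rewrite !mulr1 !scale1r -addrA -sumrB !scalerDr !scaler_sumr opprD.
rewrite addrACA -scalerBl; congr (_ + _); first by congr (_ *: _); ring.
rewrite -sumrB; apply: eq_bigr => j _.
rewrite !lift0 (_ : (n - 2 * j)%N = n.+2 - 2 * j.+1)%N; last by lia.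
by rewrite -scalerBl !scalerA -!scalerBl hcoef_rec.
Qed.

Lemma hpoly01 J b a w : (0 < J)%N ->
  (hpoly J b 0 a w = 1) * (hpoly J b 1 a w = a).
Proof.
case: J => [//|J] _; split; rewrite /hpoly big_ord_recl hcoef0 scale1r mulr1;
  rewrite ?subn0 ?expr0 ?expr1 big1 ?addr0 // => j _;
  by rewrite hcoef_small ?scale0r // lift0; lia.
Qed.

(** Up to normalisation, the sum is the coefficient of [t^n] in [(1 - x t)^(-l) (1 - y t)^(-l)] with
    [x = a + v], [y = a - v]. As [x + y = 2 a] and [x y = a^2 - v^2], [cauchy_product_rec] gives the
    recurrence of [hpoly_rec], and the two sides agree in degrees 0 and 1. *)
Lemma hpoly_gegenbauer J l n a v : 0 < l -> (n < 2 * J)%N ->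
  hpoly J (l + 2^-1) n a (v ^+ 2)
  = \sum_(s < n.+1)
      ('C(n, s)%:R * (rising l (n - s) * rising l s / rising (2 * l) n))
      *: ((a + v) ^+ (n - s) * (a - v) ^+ s).
Proof.
move=> l0 nJ; pose t s := rising l s / s`!%:R.
have tS s : s.+1%:R * t s.+1 = (l + s%:R) * t s.
  rewrite /t risingS factS natrM; field.
  by rewrite nat1r !pnatr_eq0 -lt0n fact_gt0.
pose T (z : A) s := t s *: z ^+ s.
have natA p : p%:R = (p%:R)%:A :> A by rewrite scaler_nat.
have recT z s : s.+1%:R * T z s.+1 = (l%:A + s%:R) * z * T z s.
  rewrite /T !natA -scalerDl -!scalerAl !mul1r -scalerAr !scalerA.
  by rewrite tS -exprS.
pose G p := \sum_(s < p.+1) T (a + v) (p - s)%N * T (a - v) s.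
have recG p : p.+2%:R * G p.+2
    = (l%:A + p.+1%:R) * ((a + v) + (a - v)) * G p.+1
      - (2 * l%:A + p%:R) * ((a + v) * (a - v)) * G p.
  exact: cauchy_product_rec (recT (a + v)) (recT (a - v)).
have l20 : 0 < 2 * l by rewrite mulr_gt0.
have r0 p : rising (2 * l) p != 0 by rewrite lt0r_neq0 // rising_gt0.
have f0 p : p`!%:R != 0 :> R by rewrite pnatr_eq0 -lt0n fact_gt0.
(* The factor [(2l)_n / n!] is the value that [G n] takes for [a = 1], [v = 0], where [hpoly] is
   1. *)
suff GE : G n = (rising (2 * l) n / n`!%:R) *: hpoly J (l + 2^-1) n a (v ^+ 2).
  transitivity ((n`!%:R / rising (2 * l) n) *: G n).
    rewrite GE scalerA -[LHS]scale1r; congr (_ *: _).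
    by field; rewrite f0 r0.
  rewrite scaler_sumr; apply: eq_bigr => -[s /=]; rewrite ltnS => sn _.
  rewrite /T -scalerAl -scalerAr !scalerA; congr (_ *: _).
  by rewrite /t -(bin_fact sn) !natrM; field; rewrite !f0 r0.
have J0 : (0 < J)%N by lia.
elim/ltn_ind: n nJ => -[|[|n]] IH nJ.
- rewrite /G big_ord1 subnn /T /t fact0 /rising big_ord0 !divr1 !scale1r mulr1.
  by rewrite hpoly01 // big_ord0 scale1r expr0.
- rewrite /G !big_ord_recl big_ord0 /= /T /t /rising !(big_ord0, big_ord1).
  rewrite !addr0 !divr1 !scale1r mul1r mulr1 -scalerDr.
  rewrite hpoly01 //.
  by rewrite addrACA subrr addr0 -mulr2n -[a *+ 2]scaler_nat scalerA mulrC.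
have n20 : n.+2%:R != 0 :> R by rewrite pnatr_eq0.
apply: (scalerI n20); rewrite scaler_nat -[LHS]mulr_natl recG.
rewrite !IH //; try by lia.
rewrite scalerA.
have -> : n.+2%:R * (rising (2 * l) n.+2 / (n.+2)`!%:R)
          = rising (2 * l) n.+1 / (n.+1)`!%:R * (2 * l + n.+1%:R).
  rewrite risingS [n.+2`!]factS natrM; field.
  by rewrite f0 -natrD pnatr_eq0.
rewrite -[in RHS]scalerA hpoly_rec // scalerBr !(@scalerA R A).
have -> : (l%:A + n.+1%:R) * (a + v + (a - v)) = (2 * (l + n.+1%:R)) *: a.
  rewrite natA -scalerDl mulr_algl addrACA subrr addr0 -mulr2n.
  by rewrite -[a *+ 2]scaler_nat scalerA mulrC.
have -> : (2 * l%:A + n%:R) * ((a + v) * (a - v))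
          = (2 * l + n%:R) *: (a ^+ 2 - v ^+ 2).
  rewrite (natA n) (natA 2) -scalerAl mul1r scalerA -scalerDl mulr_algl.
  by congr (_ *: _); ring.
rewrite -!(@scalerAl R A) -!(@scalerAr R A) !(@scalerA R A).
congr (_ *: _ - _ *: _).
  by rewrite mulrC.
by rewrite risingS factS natrM; field; rewrite f0 nat1r pnatr_eq0.
Qed.

End Algebra.
End Gegenbauer.

(** * Euler's Gamma function *)

Section GammaFunction.
Local Open Scope classical_set_scope.
Local Open Scope ring_scope.
Context {R : realType}.
Notation mu := (@lebesgue_measure R).
Implicit Types (s t a c : R).

(* [ln (t / c) < t / c] at [c = 2 (a + 1)]. *)
Lemma powR_expRN_le a : 0 <= a ->
  exists2 c, 0 < c &
    forall t, 0 <= t -> t `^ a * expR (- t) <= c * expR (- (t / 2)).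
Proof.
move=> a0; pose c := 2 * (a + 1).
have c0 : 0 < c by rewrite /c; lra.
exists (expR (a * ln c)); first exact: expR_gt0.
move=> t; rewrite le_eqVlt => /orP[/eqP<-|t0].
  rewrite mul0r oppr0 expR0 !mulr1 /powR eqxx.
  by case: eqP => [->|_]; rewrite ?mul0r ?expR0 ?expR_ge0.
rewrite /powR gt_eqF // -!expRD ler_expR.
have tc0 : 0 < t / c by rewrite divr_gt0.
have lnE : ln t = ln (t / c) + ln c.
  by rewrite -lnM ?posrE // mulfVK // gt_eqF.
have := ln_sublinear tc0; rewrite lnE mulrDr => /ltW lnt.
have : a * ln (t / c) <= a * (t / c) by rewrite ler_wpM2l.
have : a * (t / c) <= t / 2.
  rewrite mulrCA ler_wpM2l ?(ltW t0) // ler_pdivrMr // /c; lra.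
lra.
Qed.

Lemma cvg_powR_expRN a : 0 <= a -> t `^ a * expR (- t) @[t --> +oo] --> 0.
Proof.
move=> a0; have [c c0 le_c] := powR_expRN_le a a0.
apply: (@squeeze_cvgr _ _ _ _ (cst 0) (fun t => c * expR (- (t / 2)))).
- near=> t; have t0 : 0 <= t by near: t; exact: nbhs_pinfty_ge.
  by rewrite mulr_ge0 ?powR_ge0 ?expR_ge0 //= le_c.
- exact: cvg_cst.
- rewrite -[X in _ --> X](mulr0 c); apply: cvgMr.
  apply: (@cvg_comp _ _ _ (fun t => t / 2) (fun t => expR (- t)) _
    (pinfty_nbhs R)); last exact: cvgr_expR.
  by apply: gt0_cvgMly => //; rewrite invr_gt0.
Unshelve. all: by end_near. Qed.

(** The case [a = 0] stands apart: [powR 0 0] is 1, so the function is constant there. *)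
Lemma powR_right_continuous a : 0 <= a -> t `^ a @[t --> 0^'+] --> 0 `^ a.
Proof.
rewrite le_eqVlt => /orP[/eqP<-|a0]; last first.
  by rewrite powR0 ?gt_eqF //; exact: powR_cvg0.
rewrite powRr0; apply: (@cvg_trans _ (cst 1 @ 0^'+)); last exact: cvg_cst.
by apply: near_eq_cvg; near=> t; rewrite powRr0.
Unshelve. all: by end_near. Qed.

Lemma continuous_powR_expRN a : 0 <= a ->
  {within `[0, +oo[, continuous (fun t => t `^ a * expR (- t))}.
Proof.
move=> a0; have cE t : {for t, continuous (fun t => expR (- t))}.
  by apply: continuous_comp; [exact: continuousN|exact: continuous_expR].
apply/continuous_within_itvcyP; split.
  move=> t; rewrite in_itv/= andbT => t0; apply: cvgM; last exact: cE.
  have : derivable (@powR R ^~ a) t 1.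
    by apply: derivable_powR; rewrite in_itv/= andbT.
  by move/derivable1_diffP/differentiable_continuous.
apply: cvgM; first exact: powR_right_continuous.
by apply: cvg_at_right_filter; exact: cE.
Qed.

(** Domination by a multiple of the exponential density of rate 1/2. *)
Lemma integrable_powR_expRN a : 0 <= a ->
  mu.-integrable `[0, +oo[ (EFin \o (fun t => t `^ a * expR (- t))).
Proof.
move=> a0; have [c c0 le_c] := powR_expRN_le a a0.
have ipdf : mu.-integrable `[0, +oo[
    (fun t => (c * 2)%:E * (exponential_pdf 2^-1 t)%:E)%E.
  apply: integrableZl => //; apply: (integrableS measurableT) => //.
  by apply: integrable_exponential_pdf; rewrite invr_gt0.
have mf : measurable_fun `[(0 : R), +oo[ (fun t : R => t `^ a * expR (- t)).
  apply: subspace_continuous_measurable_fun => //.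
  exact: continuous_powR_expRN.
apply: (le_integrable _ _ _ ipdf) => //; first exact/measurable_EFinP.
move=> t /=; rewrite in_itv/= andbT => t0.
rewrite exponential_pdfE //= lee_fin.
rewrite !ger0_norm ?mulr_ge0 ?expR_ge0 ?powR_ge0 //.
- by rewrite -mulrA mulVKf // mulNr [2^-1 * t]mulrC; exact: le_c.
- exact: ltW.
Qed.

(** The origin is a null set; adding it gives a closed half-line, on which the integrand is
    continuous when [1 <= s]. *)
Lemma GammaE s : 1 <= s ->
  Gamma s = \int[mu]_(t in `[0, +oo[) (t `^ (s - 1) * expR (- t)).
Proof.
move=> s1; have s0 : 0 <= s - 1 by rewrite subr_ge0.
rewrite /Gamma Rintegral_itv_obnd_cbnd //.
apply: (integrableS _ _ _ (integrable_powR_expRN _ s0)) => //.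
by apply: subset_itvr; rewrite bnd_simp.
Qed.

(** Integration by parts: [h = s * f - F] is the derivative of [F t = t^s exp(-t)], which vanishes
    at 0 and at infinity, so [h] has integral zero. *)
Lemma GammaDr1 s : 1 <= s -> Gamma (s + 1) = s * Gamma s.
Proof.
move=> s1; have s0 : 0 < s by lra.
have s10 : 0 <= s - 1 by rewrite subr_ge0.
pose f t := t `^ (s - 1) * expR (- t); pose F t := t `^ s * expR (- t).
pose h t := s * f t - F t.
have If : mu.-integrable `[0, +oo[ (EFin \o f) by exact: integrable_powR_expRN.
have IF : mu.-integrable `[0, +oo[ (EFin \o F).
  by apply: integrable_powR_expRN; exact: ltW.
have Isf : mu.-integrable `[0, +oo[ (EFin \o (fun t => s * f t)).
  exact: (integrableZl _ s If).
have Ih : mu.-integrable `[0, +oo[ (EFin \o h).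
  exact: (integrableB _ Isf IF).
have ch : {within `[0, +oo[, continuous h}.
  have /continuous_within_itvcyP[cf f0] := continuous_powR_expRN _ s10.
  have /continuous_within_itvcyP[cF F0] := continuous_powR_expRN _ (ltW s0).
  apply/continuous_within_itvcyP; split=> [t t0|].
    by apply: cvgB; [apply: cvgMr; exact: cf|exact: cF].
  by apply: cvgB => //; exact: cvgMr.
have cF : {within `[0, +oo[, continuous F} := continuous_powR_expRN _ (ltW s0).
have dF t : 0 < t -> is_derive t 1 F (h t).
  move=> t0; rewrite /h /F.
  have dp := is_derive1_powR s t0.
  have de : is_derive t 1 (fun t => expR (- t)) (- expR (- t)).
    apply: (is_derive_eq (is_derive1_comp (f := expR) (g := -%R) _ _)).
    by rewrite /=; ring.
  apply: (is_derive_eq (is_deriveM dp de)); rewrite /f /GRing.scale /=; ring.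
(* The sign of [h] changes at [t = s], so the integral is split there: the half-line form of the
   fundamental theorem asks for a derivative of constant sign. *)
have hE t : 0 <= t -> h t = f t * (s - t).
  by move=> t0; rewrite /h /F -(mulr_powRB1 t0 s0) /f; ring.
have F0 : F 0 = 0 by rewrite /F powR0 ?gt_eqF // mul0r.
have dF1 t : 0 < t -> derivable F t 1 by move=> /dF[].
have FE t : 0 < t -> derive1 F t = h t.
  by move=> t0; rewrite derive1E; apply: derive_val; exact: dF.
have I0s : \int[mu]_(t in `[0, s]) h t = F s.
  rewrite /Rintegral (@continuous_FTC2 _ h F) //.
  - by rewrite F0 sube0.
  - by apply: continuous_subspaceW ch; apply: subset_itvl.
  - split; first by move=> t; rewrite in_itv/= => /andP[t0 _]; exact: dF1.
    + by have /continuous_within_itvcyP[] := cF.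
    + apply: cvg_at_left_filter; apply: differentiable_continuous.
      exact/derivable1_diffP/dF1.
  - by move=> t; rewrite in_itv/= => /andP[t0 _]; exact: FE.
have Is : \int[mu]_(t in `[s, +oo[) h t = - F s.
  rewrite /Rintegral (@le0_continuous_FTC2y _ h F s 0) //.
  - by rewrite sub0e.
  - move=> t st; rewrite hE ?(le_trans (ltW s0)) // mulr_ge0_le0 ?subr_le0 //.
    by rewrite mulr_ge0 ?powR_ge0 ?expR_ge0.
  - apply: continuous_subspaceW ch; apply: subset_itvr; rewrite bnd_simp.
    exact: ltW.
  - by apply: cvg_powR_expRN; exact: ltW.
  - apply: cvg_at_right_filter; apply: differentiable_continuous.
    exact/derivable1_diffP/dF1.
  - by move=> t st; apply: dF1; exact: lt_trans st.
  - move=> t; rewrite in_itv/= andbT => st.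
    by apply: FE; exact: lt_trans st.
have Ihs : mu.-integrable `]s, +oo[ (EFin \o h).
  apply: (integrableS _ _ _ Ih) => //; apply: subset_itvr; rewrite bnd_simp.
  exact: ltW.
have : \int[mu]_(t in `[0, +oo[) h t = 0.
  have /eqP := @Rintegral_itvB _ h (BLeft 0) +oo%O s Ih (ltW s0) isT.
  by rewrite subr_eq I0s Rintegral_itv_obnd_cbnd // Is addNr => /eqP.
rewrite RintegralB // RintegralZl // -GammaE // => /eqP.
by rewrite subr_eq0 => /eqP ->; rewrite GammaE ?addrK //; lra.
Qed.

Lemma Rintegral_expRN a : \int[mu]_(t in `[a, +oo[) expR (- t) = expR (- a).
Proof.
have cE t : {for t, continuous (fun t => expR (- t))}.
  by apply: continuous_comp; [exact: continuousN|exact: continuous_expR].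
have dE t : is_derive t 1 (fun t => - expR (- t)) (expR (- t)).
  apply: (is_derive_eq
    (is_deriveN (is_derive1_comp (f := expR) (g := -%R) _ _))).
  by rewrite /=; ring.
rewrite (@Rintegral_ge0_continuous_FTC2y _ _ (fun t => - expR (- t)) a 0).
- by rewrite sub0r opprK.
- by move=> t _; exact: expR_ge0.
- by apply: continuous_subspaceT => t; exact: cE.
- by rewrite -oppr0; apply: cvgN; exact: cvgr_expR.
- by move=> t _; case: (dE t).
- by apply: cvgN; apply: cvg_at_right_filter; exact: cE.
- by move=> t _; rewrite derive1E; exact: derive_val.
Qed.

Lemma Gamma1 : Gamma 1 = 1 :> R.
Proof.
rewrite GammaE // subrr -[RHS]expR0 -[in RHS]oppr0 -Rintegral_expRN.
by apply: eq_Rintegral => t _; rewrite powRr0 mul1r.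
Qed.

(** On [t > 1] the factor [t^(s-1)] is at least 1, so [Gamma s] is at least the integral of
    [exp(-t)] over that range, which is [exp(-1)]. *)
Lemma Gamma_gt0 s : 1 <= s -> 0 < Gamma s.
Proof.
move=> s1; have s0 : 0 <= s - 1 by rewrite subr_ge0.
have If := integrable_powR_expRN _ s0.
have sub : `]1, +oo[ `<=` `[(0 : R), +oo[.
  by apply: subset_itvr; rewrite bnd_simp.
have I0 : mu.-integrable `]1, +oo[ (EFin \o (fun t => expR (- t))).
  have -> : (fun t => expR (- t)) = (fun t => t `^ 0 * expR (- t)).
    by apply/funext => t; rewrite powRr0 mul1r.
  by apply: (integrableS _ _ _ (integrable_powR_expRN 0 (lexx 0))) => //.
have If1 : mu.-integrable `]1, +oo[
    (EFin \o (fun t => t `^ (s - 1) * expR (- t))).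
  by apply: (integrableS _ _ _ If) => //.
rewrite GammaE //; apply: lt_le_trans (expR_gt0 (- 1)) _.
rewrite -Rintegral_expRN -Rintegral_itv_obnd_cbnd //.
apply: (@le_trans _ _ (\int[mu]_(t in `]1, +oo[) (t `^ (s - 1) * expR (- t)))).
  apply: le_Rintegral => //.
  move=> t; rewrite /= in_itv/= andbT => t1.
  rewrite ler_peMl ?expR_ge0 // -[leLHS](powRr0 t).
  by apply: ler_powR => //; exact: ltW.
have <- := @Rintegral_itvB _ _ (BLeft 0) +oo%O 1 If ler01 isT.
rewrite lerBlDr lerDl; apply: Rintegral_ge0 => t _.
by rewrite mulr_ge0 ?powR_ge0 ?expR_ge0.
Qed.

Lemma Gamma_nat n : Gamma n.+1%:R = n`!%:R :> R.
Proof.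
elim: n => [|n IH]; first exact: Gamma1.
by rewrite -natr1 GammaDr1 ?ler1n // IH factS natrM.
Qed.

End GammaFunction.

(** * Partial derivatives of Clifford-valued functions *)

Section Derivatives.
Local Open Scope classical_set_scope.
Local Open Scope ring_scope.
Context {R : realType} {V : normedModType R}.
Implicit Types (f g : V -> R) (x v : V).

Lemma is_derive_bigsum (I : finType) (f : I -> V -> R) (df : I -> R) x v :
  (forall i, is_derive x v (f i) (df i)) ->
  is_derive x v (fun y => \sum_i f i y) (\sum_i df i).
Proof.
move=> fdf; elim: (index_enum I) => [|i r IHr].
  by rewrite big_nil; under eq_fun do rewrite big_nil; exact: is_derive_cst.
rewrite big_cons; under eq_fun do rewrite big_cons.
exact: (is_deriveD (fdf i) IHr).
Qed.

(** The difference quotient equals [d] for every nonzero [h]. *)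
Lemma is_derive_affine f x v (d : R) :
  (forall h : R, f (h *: v + x) = h * d + f x) -> is_derive x v f d.
Proof.
move=> fE.
have q : (fun h : R => h^-1 *: ((f \o shift x) (h *: v) - f x)) @ 0^' --> d.
  apply: (@cvg_trans _ (cst d @ 0^')); last exact: cvg_cst.
  apply: near_eq_cvg; near=> h; rewrite /= fE addrK /GRing.scale /= mulKf //.
  by near: h; exact: nbhs_dnbhs_neq.
by apply: DeriveDef; [apply: (cvgP d)|apply: cvg_lim].
Unshelve. all: by end_near. Qed.

Lemma is_derive_mul f g x v (df dg : R) :
  is_derive x v f df -> is_derive x v g dg ->
  is_derive x v (fun y => f y * g y) (df * g x + f x * dg).
Proof.
move=> fd gd; apply: (is_derive_eq (is_deriveM fd gd)).
by rewrite /GRing.scale /= addrC mulrC.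
Qed.

Lemma is_derive_exp f x v (df : R) n :
  is_derive x v f df ->
  is_derive x v (fun y => f y ^+ n) (n%:R * f x ^+ n.-1 * df).
Proof.
move=> fd; rewrite (_ : (fun y => _) = f ^+ n).
  by apply: (is_derive_eq (is_deriveX n fd)).
by apply/funext => y; rewrite fctE.
Qed.

Lemma is_derive_scale f x v (df c : R) :
  is_derive x v f df -> is_derive x v (fun y => c * f y) (c * df).
Proof. by move=> fd; apply: (is_derive_eq (is_deriveZ c fd)). Qed.

End Derivatives.

Section PartialDerivatives.
Local Open Scope classical_set_scope.
Local Open Scope ring_scope.
Context {R : realType} {m : nat}.
Local Notation V := 'rV[R]_m.+1.
Local Notation "''e_' j" := (delta_mx 0 j : V) (at level 8, j at level 2).
Implicit Types (f g : V -> clifford R m) (x : V) (j : 'I_m.+1).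

(** A relation rather than a value, so that derivability of every coordinate is carried along with
    the derivative. *)
Definition has_partial j f x (l : clifford R m) :=
  forall A, is_derive x 'e_j (fun y => ccoord (f y) A) (ccoord l A).

Lemma has_partialE j f x l : has_partial j f x l -> partial j f x = l.
Proof.
move=> fl; apply: cliffordP => A; rewrite /ccoord ffunE.
by case: (fl A).
Qed.

(** Each coordinate of a product is a finite sum of products of coordinates, so the real Leibniz
    rule applies termwise; the order of the factors is kept. *)
Lemma has_partialM j f g x df dg :
  has_partial j f x df -> has_partial j g x dg ->
  has_partial j (fun y => f y * g y) x (df * g x + f x * dg).
Proof.
move=> fd gd C; rewrite ccoordD !ccoordM -big_split /=.
under [X in is_derive _ _ X _]eq_fun do rewrite ccoordM.
apply: is_derive_bigsum => A.
by apply: is_derive_mul (gd _); apply: is_derive_scale; exact: fd.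
Qed.

Lemma is_derive_coord (i j : 'I_m.+1) x :
  is_derive x 'e_j (fun y : V => y 0 i) (i == j)%:R.
Proof. by apply: is_derive_affine => h; rewrite !mxE eqxx. Qed.

Lemma has_partial_scalar j (g : V -> R) x (dg : R) (c : clifford R m) :
  is_derive x 'e_j g dg -> has_partial j (fun y => g y *: c) x (dg *: c).
Proof.
move=> gd A; rewrite ccoordZ mulrC.
under [X in is_derive _ _ X _]eq_fun do rewrite ccoordZ mulrC.
exact: is_derive_scale.
Qed.

Lemma has_partial_cst j (c : clifford R m) x : has_partial j (fun=> c) x 0.
Proof.
move=> A; have -> : ccoord (0 : clifford R m) A = 0 by rewrite /ccoord ffunE.
exact: is_derive_cst.
Qed.

Lemma ccoord_sum (I : Type) (r : seq I) (P : pred I) (F : I -> clifford R m) A :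
  ccoord (\sum_(i <- r | P i) F i) A = \sum_(i <- r | P i) ccoord (F i) A.
Proof.
apply: (big_morph (fun a => ccoord a A)) => [a b|]; first exact: ccoordD.
by rewrite /ccoord ffunE.
Qed.

(** [e_0 = 1, e_1, ..., e_m] in one family, so that [x_0] is treated like the other coordinates. *)
Definition pgen (j : 'I_m.+1) : clifford R m := oapp cgen 1 (unlift ord0 j).

Lemma pgen0 : pgen ord0 = 1. Proof. by rewrite /pgen unlift_none. Qed.

Lemma pgen_lift i : pgen (lift ord0 i) = cgen i.
Proof. by rewrite /pgen liftK. Qed.

Lemma paravectorE x : paravector x = \sum_j x 0 j *: pgen j.
Proof.
rewrite /paravector /vec big_ord_recl pgen0; congr (_ + _).
by apply: eq_bigr => i _; rewrite pgen_lift mxE.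
Qed.

Lemma dirac_opE f x : dirac_op f x = \sum_j pgen j * partial j f x.
Proof.
rewrite /dirac_op big_ord_recl pgen0 mul1r; congr (_ + _).
by apply: eq_bigr => i _; rewrite pgen_lift.
Qed.

Lemma has_partial_paravector j x : has_partial j paravector x (pgen j).
Proof.
have -> : pgen j = \sum_i (i == j)%:R *: pgen i.
  rewrite (bigD1 j) //= eqxx scale1r big1 ?addr0 // => i /negPf ->.
  by rewrite scale0r.
move=> A; rewrite ccoord_sum.
under [X in is_derive _ _ X _]eq_fun do rewrite paravectorE ccoord_sum.
apply: is_derive_bigsum => i.
exact: (has_partial_scalar _ _ _ _ _ (is_derive_coord _ _ _)).
Qed.

(** As [pgen j] need not commute with [paravector x], the derivative of the power is built by the
    Leibniz rule from [x^(k+1) = x^k x]. *)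
Fixpoint dpower j x k : clifford R m :=
  if k is k'.+1 then dpower j x k' * paravector x + paravector x ^+ k' * pgen j
  else 0.

Lemma has_partial_power j x k :
  has_partial j (fun y => paravector y ^+ k) x (dpower j x k).
Proof.
elim: k => [|k IHk]; first exact: has_partial_cst.
under [X in has_partial _ X]eq_fun do rewrite exprSr.
by apply: has_partialM => //; exact: has_partial_paravector.
Qed.

Lemma dirac_op_powerS x k :
  dirac_op (fun y => paravector y ^+ k.+1) x
  = dirac_op (fun y => paravector y ^+ k) x * paravector x
    + \sum_j pgen j * paravector x ^+ k * pgen j.
Proof.
rewrite !dirac_opE mulr_suml -big_split; apply: eq_bigr => j _ /=.
rewrite !(has_partialE _ _ _ _ (has_partial_power _ _ _)) /= mulrDr.
by rewrite !mulrA.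
Qed.

End PartialDerivatives.

(** * The Dirac operator on powers of a paravector *)

Section Dirac.
Context {R : realType} {m : nat}.
Local Notation V := 'rV[R]_m.+1.
Implicit Types (u : 'rV[R]_m) (x : V).

(** Doubling the double sum and exchanging [i] and [j] in one copy leaves only anticommutators, and
    these vanish off the diagonal. *)
Lemma vec_sqr u : vec u * vec u = (- \sum_i u 0 i ^+ 2)%:A.
Proof.
have vv : vec u * vec u
    = \sum_i \sum_j (u 0 i * u 0 j) *: (cgen i * cgen j : clifford R m).
  rewrite {1}/vec mulr_suml; apply: eq_bigr => i _.
  rewrite mulr_sumr; apply: eq_bigr => j _.
  by rewrite -scalerAl -scalerAr scalerA.
have v2 : 2 *: (vec u * vec u) = 2 *: ((- \sum_i u 0 i ^+ 2)%:A : clifford R m).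
  rewrite scaler_nat mulr2n {1}vv vv [X in _ + X]exchange_big -big_split /=.
  transitivity (\sum_i (- 2 * u 0 i ^+ 2)%:A : clifford R m).
    apply: eq_bigr => i _; rewrite -big_split (bigD1 i) //= big1 => [|j ji].
      rewrite -scalerDr cgen_anticomm eqxx mulr1 scalerA addr0.
      by rewrite mulrC expr2.
    rewrite [u 0 j * _]mulrC -scalerDr cgen_anticomm eq_sym (negPf ji).
    by rewrite mulr0 scale0r scaler0.
  by rewrite -scaler_suml -mulr_sumr scalerA mulrN mulNr.
by apply: (scalerI _ v2); rewrite pnatr_eq0.
Qed.

Lemma cgen_sqr (j : 'I_m) : cgen j * cgen j = -1 :> clifford R m.
Proof.
have := @cgen_anticomm R m j j; rewrite eqxx mulr1 -mulr2n -scaler_nat => cc.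
apply: (scalerI (_ : 2 != 0 :> R)); rewrite ?pnatr_eq0 // cc.
by rewrite scaleNr scalerN.
Qed.

(** [e_j e_l e_j] is [e_l] for [j != l] and [- e_l] for [j = l]: [m - 1] plus signs against one
    minus sign. *)
Lemma cgen_vec_cgen u :
  \sum_j cgen j * vec u * cgen j = (m%:R - 2) *: vec u.
Proof.
rewrite /vec.
under eq_bigr do rewrite mulr_sumr mulr_suml.
rewrite exchange_big scaler_sumr; apply: eq_bigr => l _.
under eq_bigr do rewrite -scalerAr -scalerAl.
rewrite -scaler_sumr scalerA mulrC -scalerA; congr (_ *: _).
have E j : cgen j * cgen l * cgen j = cgen l - (2 * (j == l)%:R) *: cgen l
    :> clifford R m.
  rewrite -[cgen j * cgen l](addrK (cgen l * cgen j)) cgen_anticomm mulrBl.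
  rewrite -[X in _ - X]mulrA cgen_sqr mulrN1 opprK addrC mulr_algl mulNr.
  rewrite scaleNr.
  by case: eqVneq => [->|_]; rewrite ?mulr0 ?scale0r.
under eq_bigr do rewrite E.
rewrite sumrB sumr_const card_ord -scaler_nat scalerBl; congr (_ - _).
rewrite -scaler_suml (bigD1 l) //= eqxx mulr1 big1 ?addr0 // => j /negPf ->.
by rewrite mulr0.
Qed.

(** With [e_0 = 1] included, scalars are multiplied by [1 - m] and vectors by [1 + (m - 2) = m - 1],
    hence the conjugate. *)
Lemma sum_pgen_paravector (a b : R) u :
  \sum_j pgen j * (a%:A + b *: vec u) * pgen j
  = (1 - m%:R) *: (a%:A - b *: vec u).
Proof.
rewrite big_ord_recl pgen0 mul1r mulr1.
under eq_bigr do rewrite pgen_lift mulrDr mulrDl mulr_algr -scalerAl cgen_sqr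
  -scalerAr -scalerAl.
rewrite big_split /= -!scaler_sumr cgen_vec_cgen sumr_const card_ord.
rewrite -scaler_nat !scalerA scalerN addrACA scalerBr !scalerA -scaleNr -!scalerDl.
by rewrite -scaleNr; congr (_ *: _ + _ *: _); ring.
Qed.

(** Since [v^2] is a scalar, the span of 1 and [v] is closed under products, and [v -> - v]
    exchanges [x] and [xbar]. *)
Lemma paravector_power x k : exists a b : R,
  paravector x ^+ k = a%:A + b *: vec (xvec x)
  /\ paraconj x ^+ k = a%:A - b *: vec (xvec x).
Proof.
elim: k => [|k [a [b [Ek Ck]]]].
  by exists 1, 0; rewrite !expr0 scale0r addr0 subr0 scale1r.
(* Read off from [(a + b v) (x0 + v) = (a x0 + b v^2) + (a + b x0) v]. *)
exists (a * x 0 0 + b * - \sum_i xvec x 0 i ^+ 2), (a + b * x 0 0).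
rewrite !exprSr Ek Ck /paravector /paraconj.
have v2 := vec_sqr (xvec x); set v := vec _ in v2 *; set w := - _ in v2 *.
split.
  rewrite mulrDl !mulrDr !mulr_algl mulr_algr -scalerAl v2 !scalerA !scalerDl.
  by rewrite [x 0 0 * b]mulrC [X in _ + X = _]addrC addrACA.
rewrite mulrBl !mulrBr !mulr_algl mulr_algr -scalerAl v2 !scalerA !scalerDl.
by rewrite [x 0 0 * b]mulrC opprB addrACA -opprD.
Qed.

Lemma comm_paraconj x : GRing.comm (paravector x) (paraconj x).
Proof.
rewrite /GRing.comm /paravector /paraconj mulrDl !mulrBr mulrBl !mulrDr.
by rewrite !mulr_algl !mulr_algr addrA subrK opprD addrA addrK.
Qed.

Lemma dirac_power x k :
  dirac_op (fun y => paravector y ^+ k) x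
  = (1 - m%:R) *: \sum_(s < k) paravector x ^+ (k.-1 - s) * paraconj x ^+ s.
Proof.
elim: k => [|k IHk].
  rewrite dirac_opE big_ord0 scaler0 big1 // => j _.
  by rewrite (has_partialE _ _ _ _ (has_partial_cst _ 1 _)) mulr0.
rewrite dirac_op_powerS IHk; have [a [b [Ek Ck]]] := paravector_power x k.
(* The sandwich sum contributes the new last term [xbar^k]; the earlier terms get a factor [x] on
   the right, moved past [xbar^s] because [x] and [xbar] commute. *)
rewrite Ek sum_pgen_paravector -Ck -scalerAl -scalerDr; congr (_ *: _).
rewrite big_ord_recr /= subnn mul1r; congr (_ + _).
rewrite mulr_suml; apply: eq_bigr => -[s /= sk] _.
rewrite -mulrA -[_ ^+ s * _](commrX s (comm_paraconj x)) mulrA -exprSr.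
by congr (_ ^+ _ * _); lia.
Qed.

End Dirac.

(** * Axial functions and the Laplacian *)

Section Axial.
Local Open Scope classical_set_scope.
Local Open Scope ring_scope.
Context {R : realType} {m : nat}.
Local Notation V := 'rV[R]_m.+1.
Local Notation "''e_' j" := (delta_mx 0 j : V) (at level 8, j at level 2).
Implicit Types (x : V).

Definition axial_mon (a j : nat) x : R :=
  x 0 0 ^+ a * (- \sum_i xvec x 0 i ^+ 2) ^+ j.

(** The real-valued counterpart of [hpoly], with [w] the scalar [v^2]; partial derivatives can then
    be computed on real functions. *)
Definition haxial (J : nat) (b : R) (n : nat) x : R :=
  \sum_(j < J) hcoef b n j * axial_mon (n - 2 * j) j x.

(** The Clifford algebra is not commutative, so [hpoly_gegenbauer] is used over the polynomials in
    one variable and transported by the evaluation ['X -> v]. *)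
Lemma paravector_gegenbauer J (l : R) n x : 0 < l -> (n < 2 * J)%N ->
  \sum_(s < n.+1)
    ('C(n, s)%:R * (rising l (n - s) * rising l s / rising (2 * l) n))
    *: (paravector x ^+ (n - s) * paraconj x ^+ s)
  = (haxial J (l + 2^-1) n x)%:A.
Proof.
move=> l0 nJ; set v := vec (xvec x).
have phiC (c : R) : horner_alg v c%:P = c%:A by rewrite horner_algC.
have phiX : horner_alg v 'X = v by rewrite horner_algX.
have := congr1 (horner_alg v) (hpoly_gegenbauer J l n (x 0 0)%:P 'X l0 nJ).
rewrite /hpoly !linear_sum /= => E.
transitivity (\sum_(j < J) horner_alg v (hcoef (l + 2^-1) n j
    *: ((x 0 0)%:P ^+ (n - 2 * j) * ('X ^+ 2) ^+ j))).
  rewrite E; apply: eq_bigr => s _.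
  by rewrite linearZ rmorphM !rmorphXn rmorphD rmorphB /= phiC phiX mulr_algl.
rewrite /haxial scaler_suml; apply: eq_bigr => j _.
rewrite linearZ rmorphM !rmorphXn /= phiC phiX mulr_algl expr2 vec_sqr.
by rewrite !exprZn !expr1n mulr_algl !scalerA -mulrA.
Qed.

Let w x : R := - \sum_i xvec x 0 i ^+ 2.

Let is_derive_w0 x : is_derive x 'e_0 w 0.
Proof.
apply: is_derive_affine => h; rewrite mulr0 add0r /w; congr (- _).
by apply: eq_bigr => i _; rewrite !mxE mulr0 add0r.
Qed.

Let is_derive_wi i x : is_derive x 'e_(lift ord0 i) w (- 2 * x 0 (lift ord0 i)).
Proof.
have d : is_derive x 'e_(lift ord0 i) (fun y : V => \sum_k xvec y 0 k ^+ 2)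
    (\sum_k 2%:R * xvec x 0 k ^+ 1 * (lift ord0 k == lift ord0 i)%:R).
  apply: is_derive_bigsum => k; apply: (@is_derive_exp _ _ _ _ _ _ 2).
  under [X in is_derive _ _ X _]eq_fun do rewrite mxE.
  exact: is_derive_coord.
apply: (is_derive_eq (is_deriveN d)).
rewrite (bigD1 i) //= eqxx big1 => [|k /negPf ki].
  by rewrite mxE expr1 mulr1 addr0 mulNr.
by rewrite (inj_eq lift_inj) ki mulr0.
Qed.

Let is_derive_axial0 a j x :
  is_derive x 'e_0 (axial_mon a j) (a%:R * axial_mon a.-1 j x).
Proof.
apply: is_derive_eq.
  apply: is_derive_mul; first exact: is_derive_exp (is_derive_coord _ _ _).
  exact: is_derive_exp (is_derive_w0 _).
by rewrite /axial_mon eqxx mulr1 !mulr0 addr0 mulrA.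
Qed.

Let is_derive_axiali i a j x :
  is_derive x 'e_(lift ord0 i) (axial_mon a j)
    (- 2 * j%:R * (x 0 (lift ord0 i) * axial_mon a j.-1 x)).
Proof.
apply: is_derive_eq.
  apply: is_derive_mul; first exact: is_derive_exp (is_derive_coord _ _ _).
  exact: is_derive_exp (is_derive_wi _ _).
rewrite /axial_mon -/(w x) (_ : (0 == lift ord0 i) = false) // mulr0; ring.
Qed.

Let is_derive_axialii i a j x :
  is_derive x 'e_(lift ord0 i)
    (fun y => - 2 * j%:R * (y 0 (lift ord0 i) * axial_mon a j.-1 y))
    (- 2 * j%:R * (axial_mon a j.-1 x
       - 2 * j.-1%:R * (x 0 (lift ord0 i) ^+ 2 * axial_mon a j.-2 x))).
Proof.
apply: is_derive_eq.
  apply: is_derive_scale; apply: is_derive_mul (is_derive_coord _ _ _) _.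
  exact: is_derive_axiali.
rewrite eqxx mul1r; ring.
Qed.

(** First derivatives are given at every point because the inner [partial] is rewritten as a
    function before the outer one is taken. *)
Lemma laplacian_scalar (g : V -> R) (dg ddg : 'I_m.+1 -> V -> R) :
  (forall j x, is_derive x 'e_j g (dg j x)) ->
  (forall j x, is_derive x 'e_j (dg j) (ddg j x)) ->
  laplacian (fun y => (g y)%:A : clifford R m)
  = fun x => (\sum_j ddg j x)%:A.
Proof.
move=> dgE ddgE; apply/funext => x; rewrite /laplacian scaler_suml.
apply: eq_bigr => j _; apply: has_partialE.
have -> : partial j (fun y => (g y)%:A : clifford R m) = fun y => (dg j y)%:A.
  by apply/funext => y; apply: has_partialE; exact: has_partial_scalar.
exact: has_partial_scalar.
Qed.

(** The second [x_0]-derivative lowers the power of [x_0] by two; the vector derivatives send [w^j]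
    to [- 2 j (2 (j - 1) + m) w^(j-1)]. After an index shift both land on the same monomials, and
    [hcoef_laplacian] adds them up. *)
Lemma laplacian_haxial J b n (c : R) : 0 < b -> (n.+2 < 2 * J)%N ->
  laplacian (fun y => (c * haxial J b n.+2 y)%:A : clifford R m)
  = fun x => (c * (n.+2%:R * n.+1%:R * ((2 * b - m%:R) / (2 * b)))
              * haxial J (b + 1) n x)%:A.
Proof.
move=> b0 nJ.
pose dg (i : 'I_m.+1) x := \sum_(j < J) hcoef b n.+2 j *
  (if unlift ord0 i is Some _ then
     - 2 * j%:R * (x 0 i * axial_mon (n.+2 - 2 * j) j.-1 x)
   else (n.+2 - 2 * j)%:R * axial_mon (n.+2 - 2 * j).-1 j x).
pose ddg (i : 'I_m.+1) x := \sum_(j < J) hcoef b n.+2 j *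
  (if unlift ord0 i is Some _ then
     - 2 * j%:R * (axial_mon (n.+2 - 2 * j) j.-1 x
       - 2 * j.-1%:R * (x 0 i ^+ 2 * axial_mon (n.+2 - 2 * j) j.-2 x))
   else (n.+2 - 2 * j)%:R * ((n.+2 - 2 * j).-1%:R
          * axial_mon (n.+2 - 2 * j).-2 j x)).
have dgE i x : is_derive x 'e_i (haxial J b n.+2) (dg i x).
  apply: is_derive_bigsum => j; apply: is_derive_scale.
  by case: unliftP => [k ->|->].
have ddgE i x : is_derive x 'e_i (dg i) (ddg i x).
  apply: is_derive_bigsum => j; apply: is_derive_scale.
  case: unliftP => [k ->|->]; first exact: is_derive_axialii.
  by apply: is_derive_scale; exact: is_derive_axial0.
rewrite (laplacian_scalar _ _ _ (fun i x => is_derive_scale _ _ _ _ c (dgE i x))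
  (fun i x => is_derive_scale _ _ _ _ c (ddgE i x))).
apply/funext => x; congr (_%:A); rewrite -mulr_sumr -[RHS]mulrA.
congr (_ * _); rewrite /ddg exchange_big /=.
(* [U j] comes from the second derivative in [x_0], and [- W j] from the vector variables. *)
pose U j := (n.+2 ^_ (2 * j.+1))%:R / (4 ^+ j * j`!%:R * rising b j)
  * axial_mon (n - 2 * j) j x.
pose W j := hcoef b n.+2 j * (2 * j%:R * (2 * j.-1%:R + m%:R))
  * axial_mon (n.+2 - 2 * j) j.-1 x.
transitivity (\sum_(j < J) (U j - W j)).
  apply: eq_bigr => j _.
  rewrite -mulr_sumr big_ord_recl unlift_none.
  under eq_bigr do rewrite liftK.
  rewrite -mulr_sumr sumrB sumr_const card_ord -!mulr_sumr -mulr_suml mulrDr.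
  have sumE : \sum_i x 0 (lift ord0 i) ^+ 2 = - w x.
    by rewrite opprK; apply: eq_bigr => i _; rewrite mxE.
  congr (_ + _).
    rewrite /U /hcoef (_ : 2 * j.+1 = (2 * j).+2)%N; last by lia.
    rewrite !ffactnSr !natrM subnS.
    rewrite (_ : (n.+2 - 2 * j).-2 = n - 2 * j)%N; last by lia.
    ring.
  rewrite /W sumE -mulr_natr.
  (* For [j] equal to 0 or 1 the truncated exponent [j.-2] carries a zero factor. *)
  case: (nat_of_ord j) => [|[|i]] /=; try ring.
  by rewrite /axial_mon -/(w x) (exprS _ i); ring.
rewrite sumrB /haxial; case: J nJ {dg ddg dgE ddgE} => [//|J] nJ.
(* The first [W] and the last [U] vanish; dropping them aligns [W j.+1] with [U j]. *)
rewrite [X in _ - X]big_ord_recl big_ord_recr [in RHS]big_ord_recr /=.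
rewrite (_ : U J = 0); last by rewrite /U ffact_small ?mul0r //; lia.
rewrite (_ : W 0%N = 0); last by rewrite /W mulr0 mul0r mulr0 mul0r.
rewrite (@hcoef_small _ _ n J) ?mul0r ?addr0 ?add0r; last by lia.
rewrite -sumrB mulr_sumr; apply: eq_bigr => j _.
rewrite (mulrA _ (hcoef _ _ _)) -hcoef_laplacian // mulrBl; congr (_ - _).
by rewrite /W /bump /= add1n (_ : (n.+2 - 2 * j.+1 = n - 2 * j)%N); last by lia.
Qed.

End Axial.

(** * Pochhammer symbols as rising factorials *)

Section GammaValues.
Context {R : realType}.
Implicit Types (s : R).

Lemma Gamma_rising s n : 1 <= s -> Gamma (s + n%:R) = rising s n * Gamma s.
Proof.
move=> s1; elim: n => [|n IHn]; first by rewrite addr0 /rising big_ord0 mul1r.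
by rewrite -natr1 addrA GammaDr1 ?ler_wpDr // IHn risingS; ring.
Qed.

Lemma pochhammerE s n : 1 <= s -> pochhammer s n = rising s n.
Proof.
by move=> s1; rewrite /pochhammer Gamma_rising // mulfK // gt_eqF // Gamma_gt0.
Qed.

End GammaValues.

(** * The harmonic CK-extension of a monomial, and the polynomials [P_n^m] *)

Section HarmonicCK.
Local Open Scope classical_set_scope.
Local Open Scope ring_scope.
Context {R : realType} {m : nat}.

Lemma cseries_finite (u : nat -> clifford R m) J :
  (forall j, (J <= j)%N -> u j = 0) -> cseries u = \sum_(j < J) u j.
Proof.
move=> uJ; apply: cliffordP => A; rewrite ccoord_sum /ccoord ffunE.
apply: cvg_lim => //; apply: cvg_near_cst; near=> N.
have JN : (J <= N)%N by near: N; exact: nbhs_infty_ge.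
rewrite /series /= (@big_cat_nat _ _ _ J) //= big_mkord.
rewrite [X in _ + X]big_nat_cond [X in _ + X]big1 ?addr0 // => j.
case/andP=> /andP[Jj _] _.
by rewrite uJ // /ccoord ffunE.
Unshelve. all: by end_near. Qed.

Lemma derive1n_monomial n k (c : R) :
  derive1n k (fun t => t ^+ n * c) = fun t => (n ^_ k)%:R * (t ^+ (n - k) * c).
Proof.
elim: k => [|k IHk]; first by apply/funext => t; rewrite mul1r subn0.
rewrite derive1nS IHk; apply/funext => t; rewrite derive1E.
have d : is_derive t 1 (fun t : R => (n ^_ k)%:R * (t ^+ (n - k) * c))
    ((n ^_ k)%:R * ((n - k)%:R * t ^+ (n - k).-1 * 1 * c + t ^+ (n - k) * 0)).
  apply: is_derive_scale; apply: is_derive_mul (is_derive_cst _ _ _).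
  exact: is_derive_exp.
rewrite derive_val ffactnSr natrM subnS; ring.
Qed.

Lemma cderiv_monomial n k t :
  cderiv k (fun t => (t ^+ n)%:A : clifford R m) t
  = ((n ^_ k)%:R * t ^+ (n - k))%:A.
Proof.
apply: cliffordP => A; rewrite ccoordZ {1}/ccoord ffunE.
under [X in derive1n _ X]eq_fun do rewrite ccoordZ.
by rewrite derive1n_monomial mulrA.
Qed.

Lemma cderiv0 k t : cderiv k (fun=> 0 : clifford R m) t = 0.
Proof.
have c0 A : ccoord (0 : clifford R m) A = 0 by rewrite /ccoord ffunE.
apply: cliffordP => A; rewrite c0 /ccoord ffunE.
have -> : (fun _ : R => ccoord (0 : clifford R m) A) = (fun s => s ^+ 0 * 0).
  by apply/funext => s; rewrite mulr0 c0.
by rewrite derive1n_monomial !mulr0.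
Qed.

(** Derivatives of [t^n] of order above [n] vanish, so the series is a finite sum;
    [Gamma (m/2) / Gamma (m/2 + j)] is [1 / (m/2)_j], and [(-1)^j |v|^(2j)] is [w^j]. *)
Lemma HGCK_monomial J n (x : 'rV[R]_m.+1) : (2 <= m)%N -> (n < 2 * J)%N ->
  HGCK (fun t => (t ^+ n)%:A) (fun=> 0) (x 0 0) (xvec x)
  = (haxial J (m%:R / 2) n x)%:A.
Proof.
move=> m2 nJ; rewrite /HGCK.
have mh : 1 <= m%:R / 2 :> R by rewrite ler_pdivlMr // mul1r ler_nat.
have G0 := Gamma_gt0 _ mh.
rewrite (@cseries_finite _ J) => [|j Jj]; last first.
  by rewrite cderiv_monomial ffact_small ?mul0r ?scale0r ?scaler0 //; lia.
rewrite (@cseries_finite _ 0) => [|j _]; last by rewrite cderiv0 scaler0.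
rewrite big_ord0 mulr0 scaler0 addr0 scaler_sumr /haxial scaler_suml.
apply: eq_bigr => j _; rewrite cderiv_monomial !scalerA; congr (_ *: _).
have q0 : 0 <= \sum_i xvec x 0 i ^+ 2 by apply: sumr_ge0 => i _; exact: sqr_ge0.
rewrite /enorm exprM sqr_sqrtr // Gamma_rising //.
rewrite /hcoef /axial_mon [in RHS]exprNn.
have := hcoef_den _ j (lt_le_trans ltr01 mh).
rewrite exprM (_ : 2 ^+ 2 = 4); last by ring.
rewrite !mulf_eq0 !negb_or => /andP[/andP[p0 f0] r0].
by field; rewrite p0 f0 r0 gt_eqF.
Qed.

(** This is the Gegenbauer sum of index [l = (m - 1)/2]: then [2 l = m - 1] and [l + 1/2 = m/2], and
    [3 <= m] gives [1 <= l], as [pochhammerE] asks. *)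
Lemma Ppoly_monomial J n (x : 'rV[R]_m.+1) : (3 <= m)%N -> (n < 2 * J)%N ->
  Ppoly n x = (haxial J (m%:R / 2) n x)%:A.
Proof.
move=> m3 nJ; pose l : R := m.-1%:R / 2.
have l1 : 1 <= l by rewrite ler_pdivlMr // mul1r ler_nat; lia.
have l2 : m.-1%:R = 2 * l by rewrite mulrCA divff ?mulr1 // pnatr_eq0.
have -> : m%:R / 2 = l + 2^-1.
  have -> : m%:R = m.-1%:R + 1 :> R by rewrite natr1 prednK //; lia.
  by rewrite /l; field.
rewrite -paravector_gegenbauer ?(lt_le_trans ltr01) // /Ppoly big_mkord.
have l21 : 1 <= 2 * l by lra.
by apply: eq_bigr => s _; rewrite -/l l2 !pochhammerE.
Qed.

End HarmonicCK.

(** * The constant [gamma_m] *)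

Section Constant.
Context {R : realType}.

Lemma prod_sub_double (p : nat) :
  \prod_(i < p) (2 * i%:R - 2 * p%:R) = (- 2) ^+ p * p`!%:R :> R.
Proof.
elim: p => [|p IHp]; first by rewrite big_ord0 expr0 mulr1.
rewrite big_ord_recl (eq_bigr (fun i : 'I_p => 2 * i%:R - 2 * p%:R)).
  by rewrite IHp exprS factS natrM /=; ring.
by move=> i _; rewrite lift0; ring.
Qed.

(** The product is the double factorial [(2p+1)!!]. *)
Lemma prod_odd (p : nat) :
  (\prod_(i < p) (2 * i%:R + 3)) * (2 ^+ p * p`!%:R) = ((2 * p).+1)`!%:R :> R.
Proof.
elim: p => [|p IHp]; first by rewrite big_ord0 muln0 mulr1 mul1r.
rewrite big_ord_recr /= (_ : (2 * p.+1).+1 = (2 * p).+3)%N; last by lia.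
rewrite (factS (2 * p).+2) (factS (2 * p).+1) (factS p) exprS.
move: (_.+1)`! IHp => F; rewrite !natrM => <-.
ring.
Qed.

(** The right side is what the operators accumulate: [1 - m] from [D], and [(2b - m)/(2b)] from each
    Laplacian at [b = 3/2 + i]. As [(m + 1)/2 = p + 2], the Gamma value is [(p+1)!]. *)
Lemma gamma_constE (p : nat) (m := (2 * p).+3) :
  gamma_const R m = (1 - m%:R) *
    \prod_(i < p) ((2 * (3 / 2 + i%:R) - m%:R) / (2 * (3 / 2 + i%:R))).
Proof.
rewrite /gamma_const.
rewrite (_ : m.+1%:R / 2 = p.+2%:R :> R); last first.
  rewrite (_ : m.+1 = 2 * p.+2)%N; last by rewrite /m; lia.
  by rewrite natrM; field.
rewrite Gamma_nat (_ : m.-1./2 = p.+1); last by rewrite /m /=; lia.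
rewrite prodf_div.
have -> : \prod_(i < p) (2 * (3 / 2 + i%:R) - m%:R)
          = \prod_(i < p) (2 * i%:R - 2 * p%:R) :> R.
  apply: eq_bigr => i _; rewrite /m (_ : (2 * p).+3 = 2 * p + 3)%N; last by lia.
  by rewrite natrD natrM; field.
have -> : \prod_(i < p) (2 * (3 / 2 + i%:R))
          = \prod_(i < p) (2 * i%:R + 3) :> R.
  by apply: eq_bigr => i _; field.
rewrite prod_sub_double.
have := prod_odd p; set Q := \prod_(i < p) _ => QE.
have f0 : (p`!)%:R != 0 :> R by rewrite pnatr_eq0 -lt0n fact_gt0.
have t0 : 2 ^+ p != 0 :> R by rewrite expf_neq0 // pnatr_eq0.
have Q0 : Q != 0.
  apply/eqP => Q0; move/eqP: QE; rewrite Q0 mul0r eq_sym pnatr_eq0.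
  by rewrite -leqn0 leqNgt fact_gt0.
rewrite /m [_.-1]/= (factS (2 * p).+1) (factS p).
move: (_.+1)`! QE => F; rewrite !natrM => <-.
have -> : 2 ^+ (2 * p).+2 = 4 * 2 ^+ p * 2 ^+ p :> R.
  by rewrite !exprS mul2n -addnn exprD; ring.
have -> : (- 2) ^+ p = (-1) ^+ p * 2 ^+ p :> R by rewrite -exprMn mulN1r.
have pE : (2 * p).+2%:R = 2 * p.+1%:R :> R by rewrite -natrM mulnS add2n.
have -> : 1 - (2 * p).+3%:R = - (2 * p.+1%:R) :> R by rewrite -pE -natr1; ring.
have p0 : p.+1%:R != 0 :> R by rewrite pnatr_eq0.
rewrite pE (exprS (-1) p).
move: (p`!%:R) (2 ^+ p) ((-1) ^+ p) (p.+1%:R) Q f0 t0 Q0 p0.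
move=> f t e q {}Q f0 t0 Q0 q0.
by field; rewrite q0 Q0 t0 f0.
Qed.

End Constant.

(** * Iterated Laplacians of [D x^k], and their identification with the extension *)

Section Fueter.
Context {R : realType} {m : nat}.

(** For index [l = 1] one has [(1)_s = s!] and [(2)_k = (k+1)!], so every Gegenbauer weight is
    [1/(k+1)] and the sum is the one in [dirac_power]. *)
Lemma dirac_power_axial J k : (k < 2 * J)%N ->
  dirac_op (fun y : 'rV[R]_m.+1 => paravector y ^+ k.+1)
  = fun x => ((1 - m%:R) * k.+1%:R * haxial J (3 / 2) k x)%:A.
Proof.
move=> kJ; apply/funext => x; rewrite dirac_power -!mulrA -scalerA.
congr (_ *: _); have -> : 3 / 2 = 1 + 2^-1 :> R by field.
rewrite -scalerA -(paravector_gegenbauer _ _ _ _ ltr01 kJ) scaler_sumr.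
apply: eq_bigr => -[s /=]; rewrite ltnS => sk _.
have rising1 n : rising 1 n = n`!%:R :> R.
  elim: n => [|n IHn]; first by rewrite /rising big_ord0.
  by rewrite risingS IHn factS natrM nat1r mulrC.
have -> : rising (2 * 1) k = (k.+1)`!%:R :> R.
  by rewrite -rising1 rising_shift mul1r mulr1.
rewrite !rising1 scalerA -[LHS]scale1r; congr (_ *: _).
have f0 n : n`!%:R != 0 :> R by rewrite pnatr_eq0 -lt0n fact_gt0.
have k0 : k.+1%:R != 0 :> R by rewrite pnatr_eq0.
rewrite factS natrM -(bin_fact sk) !natrM; field.
by rewrite !f0 nat1r k0 pnatr_eq0 -lt0n bin_gt0 sk.
Qed.

(** Each Laplacian raises [b] by one and lowers the degree by two; its two degree factors extend the
    falling factorial of [k.+1]. *)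
Lemma iter_laplacian_dirac_power J k i : (k < 2 * J)%N -> (2 * i <= k)%N ->
  iter i laplacian (dirac_op (fun y : 'rV[R]_m.+1 => paravector y ^+ k.+1))
  = fun x => ((1 - m%:R)
      * \prod_(l < i) ((2 * (3 / 2 + l%:R) - m%:R) / (2 * (3 / 2 + l%:R)))
      * (k.+1 ^_ (2 * i).+1)%:R * haxial J (3 / 2 + i%:R) (k - 2 * i) x)%:A.
Proof.
move=> kJ; elim: i => [|i IHi] ik.
  rewrite /= (dirac_power_axial _ _ kJ); apply/funext => x.
  by rewrite big_ord0 mulr1 muln0 subn0 ffactn1 addr0.
rewrite iterS IHi; last by lia.
have -> : (k - 2 * i = (k - 2 * i.+1).+2)%N by lia.
rewrite laplacian_haxial; last 2 first.
- by rewrite ltr_wpDr // divr_gt0.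
- by lia.
apply/funext => x; congr ((_ * _)%:A); last by rewrite -[i.+1%:R]natr1 addrA.
rewrite big_ord_recr /= (_ : (2 * i.+1).+1 = (2 * i).+3)%N; last by lia.
rewrite !ffactnSr !natrM.
have -> : (k.+1 - (2 * i).+1 = (k - 2 * i.+1).+2)%N by lia.
have -> : (k.+1 - (2 * i).+2 = (k - 2 * i.+1).+1)%N by lia.
by ring.
Qed.

End Fueter.

Theorem theorem6p8 (R : realType) (m k : nat) (m_ge3 : (3 <= m)%N)
    (m_odd : odd m) (k_ge : (m - 2 <= k)%N) (x : 'rV[R]_m.+1) :
  let n := (k - (m - 2))%N in
  let c : R := gamma_const R m * (k`!%:R / n`!%:R) in
  [/\ iter ((m - 3) %/ 2) laplacian (dirac_op (fun y => paravector y ^+ k)) x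
        = c *: HGCK (fun t => (t ^+ n)%:A) (fun _ => 0) (x 0 0) (xvec x)
    & c *: HGCK (fun t => (t ^+ n)%:A) (fun _ => 0) (x 0 0) (xvec x)
        = c *: Ppoly n x ].
Proof.
(* This makes [k] a common truncation bound [J] for all the sums below. *)
move=> n c; have nk : (n < 2 * k)%N by rewrite /n; lia.
rewrite (HGCK_monomial k) //; last by lia.
rewrite (Ppoly_monomial k) //; split=> //.
have [p mE] : exists p, m = (2 * p).+3 by exists ((m - 3) %/ 2)%N; lia.
have [k' kE] : exists k', k = k'.+1 by exists k.-1; lia.
have -> : ((m - 3) %/ 2 = p)%N by lia.
have -> : (fun y : 'rV[R]_m.+1 => paravector y ^+ k)
          = fun y => paravector y ^+ k'.+1 by rewrite kE.
rewrite (iter_laplacian_dirac_power k); [|lia..].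
have -> : (k' - 2 * p = n)%N by rewrite /n; lia.
rewrite /c scalerA; congr (_%:A).
have -> : gamma_const R m = (1 - m%:R) *
    \prod_(i < p) ((2 * (3 / 2 + i%:R) - m%:R) / (2 * (3 / 2 + i%:R))).
  by rewrite mE gamma_constE.
have -> : 3 / 2 + p%:R = m%:R / 2 :> R.
  by rewrite mE (_ : (2 * p).+3 = 2 * p + 3)%N ?natrD ?natrM; [field|lia].
congr (_ * _ * _).
(* As [2p + 1 = m - 2], the falling factorial [k ^_ (2p+1)] is [k! / n!]. *)
rewrite -(@ffact_fact k (2 * p).+1); last by lia.
rewrite natrM (_ : (k - (2 * p).+1 = n)%N); last by rewrite /n; lia.
by rewrite mulfK -?kE // pnatr_eq0 -lt0n fact_gt0.
Qed.
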